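(* Let $P$, $p$, $\delta\in(0,1)$, the defensive random proposal density $\hat q=\hat q_\delta=(1-\delta)\hat q_0+\delta\varphi$, the samples $X_1,\dots,X_n$, the random variable $Z\sim P$ and the integrand $f\in L^2(P)$ be as specified in the context; in particular $$\Bigl\|\tfrac{f^2\sqrt p}{\varphi}\Bigr\|_{L^2(P)}<\infty,\quad \Bigl\|\tfrac{\sqrt p}{\varphi}\Bigr\|_{L^2(P)}<\infty,\quad \int_{\mathbb{R}^d}|p-\varphi|f^2\,\mathrm{d}x<\infty,\quad \mathrm{MISE}(\hat q_0)<\infty.$$ Define $$\sigma_\delta^2(f)=\operatorname{Var}[f(Z)]+\frac1\delta\,\mathrm{MISE}(\hat q_0)^{1/2}\Bigl\|\frac{f^2\sqrt p}{\varphi}\Bigr\|_{L^2(P)}+\frac{\delta}{1-\delta}\int_{\mathbb{R}^d}|p-\varphi|\,f^2\,\mathrm{d}x .$$ Then the estimator $\mathcal{I}_n(f)=\frac1n\sum_{i=1}^n\frac{p(X_i)}{\hat q_\delta(X_i)}f(X_i)$ is an unbiased estimator of $\mathcal{I}(f)=\int f p\,\mathrm{d}x$ and satisfies $$\operatorname{Var}[\mathcal{I}_n(f)]\le\frac{\sigma_\delta^2(f)}{n},\qquad \mathbb{E}\bigl[|\mathcal{I}_n(f)-\mathcal{I}(f)|\bigr]\le\frac{\sigma_\delta(f)}{\sqrt n}.$$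
   Context: Setting. $(\Omega,\Sigma,\mathbb{P})$ is a probability space; $\mathcal{P}(\mathbb{R}^d)$ is the space of Borel probability measures on $\mathbb{R}^d$ with the Borel $\sigma$-algebra of the weak topology. $P\in\mathcal{P}(\mathbb{R}^d)$ has strictly positive Lebesgue density $p$. The random proposal $\hat Q$ is a $\mathcal{P}(\mathbb{R}^d)$-valued random variable, measurable with respect to a sub-$\sigma$-algebra $\mathcal{F}\subseteq\Sigma$, with $P\ll\hat Q$ a.s. and with Lebesgue density $$\hat q=\hat q_\delta=(1-\delta)\hat q_0+\delta\varphi,\qquad\delta\in(0,1),$$ where $\hat q_0$ is a random probability density and $\varphi$ is a deterministic probability density that is strictly positive on $\mathbb{R}^d$. Conditionally on $\hat Q$, $X_1,\dots,X_n$ are conditionally independent with common distribution $\hat Q$. $Z\sim P$ is a random variable independent of $\mathcal{F}$. The mean integrated squared error is $\mathrm{MISE}(\hat q_0)=\mathbb{E}\int_{\mathbb{R}^d}(\hat q_0(x)-p(x))^2\,\mathrm{d}x$. $L^2(P)$ norms are with respect to the measure $P$. $\sigma_\delta(f)$ denotes the nonnegative square root of $\sigma_\delta^2(f)$. *)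

(* Defs.v *)
From HB Require Import structures.
From mathcomp Require Import all_boot all_order all_algebra.
From mathcomp Require Import all_classical all_reals all_analysis.
From mathcomp Require Import measurable_realfun.

Set Implicit Arguments.
Unset Strict Implicit.
Unset Printing Implicit Defensive.

Import Order.TTheory GRing.Theory Num.Theory.
Import numFieldTopology.Exports numFieldNormedType.Exports.

Local Open Scope classical_set_scope.
Local Open Scope ring_scope.

(** R^d is [d.-tuple R]; the library equips it with the product sigma-algebra
    of the Borel sigma-algebra of R, i.e., the Borel sigma-algebra of R^d. *)

Section lebesgue_cons.
Context (R : realType) (n : nat).
Variable m : {sigma_finite_measure set (n.-tuple R) -> \bar R}.
Local Open Scope ereal_scope.

Let cons_pair (z : measurableTypeR R * n.-tuple R) : n.+1.-tuple R :=
  [the n.+1.-tuple R of z.1 :: z.2].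

Let mcons : measurable_fun setT cons_pair.
Proof.
by apply: measurable_cons; [exact: measurable_fst|exact: measurable_snd].
Qed.

(** Image of (Lebesgue on R) x m under R x R^n = R^(n+1). *)
Definition lebesgue_cons : set (n.+1.-tuple R) -> \bar R :=
  pushforward (@lebesgue_measure R \x m) cons_pair.

Let lebesgue_cons0 : lebesgue_cons set0 = 0.
Proof. by rewrite /lebesgue_cons /pushforward preimage_set0 measure0. Qed.

Let lebesgue_cons_ge0 A : 0 <= lebesgue_cons A.
Proof. exact: measure_ge0. Qed.

Let lebesgue_cons_sigma_additive : semi_sigma_additive lebesgue_cons.
Proof.
move=> F mF tF mUF; rewrite /lebesgue_cons /pushforward preimage_bigcup.
apply: measure_semi_sigma_additive.
- by move=> i; rewrite -[X in measurable X]setTI; exact: mcons.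
- apply/trivIsetP => /= i j _ _ ij; rewrite -preimage_setI.
  by move/trivIsetP : tF => /(_ _ _ _ _ ij) ->//; rewrite preimage_set0.
- by rewrite -preimage_bigcup -[X in measurable X]setTI; exact: mcons.
Qed.

HB.instance Definition _ := isMeasure.Build _ _ _
  lebesgue_cons lebesgue_cons0 lebesgue_cons_ge0 lebesgue_cons_sigma_additive.

Lemma lebesgue_cons_rect (A : set R) (B : set (n.-tuple R)) :
  measurable A -> measurable B ->
  lebesgue_cons [set x | A (thead x) /\ B [tuple of behead x]] =
  lebesgue_measure A * m B.
Proof.
move=> mA mB; rewrite -product_measure1E//; congr (product_measure1 _ _ _).
apply/seteqP; split => -[a b] /=; rewrite theadE => -[Aa Bb]; split => //=.
  by rewrite (_ : b = [tuple of behead (a :: b)])//; exact: val_inj.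
by rewrite (_ : [tuple of _] = b)//; exact: val_inj.
Qed.

Let lebesgue_cons_sigma_finite : sigma_finite setT lebesgue_cons.
Proof.
have /sigma_finiteP[F [Fcov ndF Ffin]] := @sigma_finiteT _ _ _ (@lebesgue_measure R).
have /sigma_finiteP[G [Gcov ndG Gfin]] := @sigma_finiteT _ _ _ m.
exists (fun k => [set x | F k (thead x) /\ G k [tuple of behead x]]).
  apply/seteqP; split => // x _.
  have [i _ Fi] : (\bigcup_i F i) (thead x) by rewrite -Fcov.
  have [j _ Gj] : (\bigcup_i G i) [tuple of behead x] by rewrite -Gcov.
  exists (maxn i j) => //; split.
    by have /subsetPset := ndF _ _ (leq_maxl i j); exact.
  by have /subsetPset := ndG _ _ (leq_maxr i j); exact.
move=> k; have [mF Fk] := Ffin k; have [mG Gk] := Gfin k; split.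
  apply: measurableI; rewrite -[X in measurable X]setTI.
    exact: (@measurable_tnth _ _ _ ord0).
  exact: (@measurable_behead _ _ _).
by rewrite lebesgue_cons_rect// lte_mul_pinfty// ge0_fin_numE.
Qed.

HB.instance Definition _ :=
  Measure_isSigmaFinite.Build _ _ _ lebesgue_cons lebesgue_cons_sigma_finite.

End lebesgue_cons.

Fixpoint lebesgue_Rd (R : realType) (d : nat) :
    {sigma_finite_measure set (d.-tuple R) -> \bar R} :=
  if d is n.+1 then lebesgue_cons (lebesgue_Rd R n) else dirac [tuple].

Lemma lebesgue_Rd_box (R : realType) (d : nat) (A : 'I_d -> set R) :
  (forall i, measurable (A i)) ->
  lebesgue_Rd R d [set x | forall i, A i (tnth x i)] =
  (\prod_(i < d) lebesgue_measure (A i))%E.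
Proof.
elim: d A => [|d IHd] A mA.
  by rewrite big_ord0 /= diracE mem_set// => -[].
rewrite big_ord_recl -(IHd (fun i => A (lift ord0 i))); last by move=> i; exact: mA.
pose B := [set x : d.-tuple R | forall i, A (lift ord0 i) (tnth x i)].
have mB : measurable B.
  rewrite (_ : B = \big[setI/setT]_(i < d)
      ((@tnth _ R ^~ i) @^-1` A (lift ord0 i))).
    apply: bigsetI_measurable => i _; rewrite -[X in measurable X]setTI.
    exact: measurable_tnth.
  apply/seteqP; split => x.
    by move=> Bx; elim/big_ind : _ => // i _; exact: Bx.
  by move=> + i; rewrite (bigD1 i)//= => -[].
rewrite -lebesgue_cons_rect//; congr (lebesgue_cons _ _).
apply/seteqP; split => x /=.
  move=> Ax; split; first exact: Ax.
  by move=> i; have := Ax (lift ord0 i); rewrite {1}[x]tuple_eta tnthS.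
move=> [A0 AS] i; have [j ->|->] := unliftP ord0 i; last exact: A0.
by rewrite {1}[x]tuple_eta tnthS; exact: AS.
Qed.

Section weak_topology.
Context (R : realType) (d : nat).

Definition Cb : Type := {g : 'rV[R]_d -> R |
  continuous g /\ exists M, forall v, `|g v| <= M}.

Definition integral_Cb (mu : probability (d.-tuple R) R) :
    prod_topology (fun _ : Cb => R) :=
  fun g => \int[mu]_x sval g (\row_i tnth x i).

(** The coarsest topology on P(R^d) making mu |-> \int g dmu continuous for
    every bounded continuous g; R^d carries the topology of ['rV[R]_d]. *)
Definition weak_prob : topologicalType := initial_topology integral_Cb.

Definition weak_borel : set (set (probability (d.-tuple R) R)) :=
  <<s @open weak_prob >>.

End weak_topology.

Section densities.
Context (R : realType) (d : nat).
Implicit Types (g : d.-tuple R -> R) (mu : probability (d.-tuple R) R).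

Definition is_density g : Prop :=
  [/\ measurable_fun [set: d.-tuple R] g, forall x, 0 <= g x &
      (\int[lebesgue_Rd R d]_x (g x)%:E = 1)%E].

Definition has_density mu g : Prop :=
  is_density g /\ forall A, measurable A ->
    mu A = (\int[lebesgue_Rd R d]_(x in A) (g x)%:E)%E.

Definition mixture (delta : R) g phi : d.-tuple R -> R :=
  fun x => (1 - delta) * g x + delta * phi x.

End densities.

Section conditioning.
Context (R : realType) (disp : measure_display) (Om : measurableType disp).
Variable Pr : probability Om R.
Implicit Types (G F : set (set Om)).

Definition is_sub_sigma_algebra F : Prop :=
  sigma_algebra setT F /\ F `<=` measurable.

(** [g] is a version of the conditional probability Pr(A | G). *)
Definition cond_prob_version G (A : set Om) (g : Om -> \bar R) : Prop :=
  measurable_fun setT (g : g_sigma_algebraType G -> \bar R) /\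
  forall B, G B -> (\int[Pr]_(w in B) g w = Pr (A `&` B))%E.

(** Taking some [A i] to be [setT] covers subfamilies. *)
Definition cond_independent disp' (T : measurableType disp') (n : nat) G
    (X : 'I_n -> {RV Pr >-> T}) : Prop :=
  forall (A : 'I_n -> set T) (g : 'I_n -> Om -> \bar R),
    (forall i, measurable (A i)) ->
    (forall i, cond_prob_version G (X i @^-1` A i) (g i)) ->
    cond_prob_version G [set w | forall i, A i (X i w)]
      (fun w => \prod_(i < n) g i w)%E.

(** [Q] is a (regular) conditional distribution of [X] given [G]. *)
Definition cond_distribution disp' (T : measurableType disp') G
    (X : {RV Pr >-> T}) (Q : Om -> probability T R) : Prop :=
  forall A, measurable A -> cond_prob_version G (X @^-1` A) (fun w => Q w A).

Definition independent_of disp' (T : measurableType disp') F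
    (Z : {RV Pr >-> T}) : Prop :=
  forall A B, measurable A -> F B ->
    (Pr ((Z @^-1` A) `&` B) = Pr (Z @^-1` A) * Pr B)%E.

(** Integrability of the estimator is part of unbiasedness, so that ['E_Pr[I]]
    is not a conventional value. *)
Definition unbiased_estimator (I : Om -> R) (theta : R) : Prop :=
  I \in Lfun Pr 1 /\ ('E_Pr[I] = theta%:E)%E.

End conditioning.

Section random_proposal.
Context (R : realType) (disp : measure_display) (Om : measurableType disp).
Variables (Pr : probability Om R) (d : nat).

(** sigma(Q), for [Q] valued in P(R^d) with the weak Borel sigma-algebra. *)
Definition sigma_of (Q : Om -> probability (d.-tuple R) R) : set (set Om) :=
  preimage_set_system setT Q (@weak_borel R d).

(** Measurability is with respect to the product of [G] and the Borel
    sigma-algebra of R^d; it is used with [G := sigma_of Q]. Without it the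
    version of the density chosen at [w] could depend on the samples (e.g., be
    altered at the point [X i w]), and conditioning on [Q] would not determine
    [fun x => q0 w x]. *)
Definition random_density (G : set (set Om)) (q0 : Om -> d.-tuple R -> R) :=
  (forall w, is_density (q0 w)) /\
  measurable_fun [set: g_sigma_algebraType G * d.-tuple R]
    (fun z : g_sigma_algebraType G * d.-tuple R => q0 z.1 z.2).

Definition MISE (q0 : Om -> d.-tuple R -> R) (p : d.-tuple R -> R) : \bar R :=
  (\int[Pr]_w \int[lebesgue_Rd R d]_x ((q0 w x - p x) ^+ 2)%:E)%E.

Definition importance_estimator (n : nat) (p : d.-tuple R -> R)
    (q : Om -> d.-tuple R -> R) (X : 'I_n -> {RV Pr >-> d.-tuple R})
    (f : d.-tuple R -> R) : Om -> R :=
  fun w => n%:R^-1 * \sum_(i < n) p (X i w) / q w (X i w) * f (X i w).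

(** || h sqrt(p) / phi ||_{L^2(P)} *)
Definition weighted_norm (P : probability (d.-tuple R) R)
    (p phi h : d.-tuple R -> R) : \bar R :=
  ('N[P]_2%:E[EFin \o (fun x => (h x * Num.sqrt (p x) / phi x)%R)])%E.

Definition weighted_L1_dist (p phi f : d.-tuple R -> R) : \bar R :=
  (\int[lebesgue_Rd R d]_x (`|p x - phi x| * f x ^+ 2)%:E)%E.

Definition sigma2 (delta : R) (P : probability (d.-tuple R) R)
    (p phi : d.-tuple R -> R) (q0 : Om -> d.-tuple R -> R)
    (Z : {RV Pr >-> d.-tuple R}) (f : d.-tuple R -> R) : \bar R :=
  ('V_Pr[f \o Z]
   + (delta^-1)%:E * sqrte (MISE q0 p)
       * weighted_norm P p phi (fun x => f x ^+ 2)%R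
   + (delta / (1 - delta))%:E * weighted_L1_dist p phi f)%E.

End random_proposal.

(* Main.v *)
Require Import Defs.
From HB Require Import structures.
From mathcomp Require Import all_boot all_order all_algebra.
From mathcomp Require Import all_classical all_reals all_analysis.
From mathcomp Require Import measurable_realfun.
From mathcomp Require Import ring.

Set Implicit Arguments.
Unset Strict Implicit.
Unset Printing Implicit Defensive.

Import Order.TTheory GRing.Theory Num.Theory.
Import numFieldTopology.Exports numFieldNormedType.Exports.

Local Open Scope classical_set_scope.
Local Open Scope ring_scope.

(** Write g := f p and W_i := g (X_i) / q (X_i), with q the random proposal
    density.  Given the proposal, each X_i has density q and X_i, X_j are
    independent, so the weight 1 / q cancels the density: the conditional mean
    of W_i is the deterministic number I = \int g, and the conditional mean of
    W_i W_j (i <> j) is I * I.  Hence the estimator is unbiased and the W_i are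
    uncorrelated, although they are not independent (they share q), and
      Var (mean of the W_i) = (E \int g^2 / q - I^2) / n.
    The first absolute moment of the error is then at most the square root of
    the variance.

    It remains to bound E \int p^2 f^2 / q.  The density p is compared with q
    through the deterministic mixture b := (1 - delta) p + delta phi:
      p^2 / q = p + p (p - b) / b + p^2 (b - q) / (b q),
    where p - b = delta (p - phi) and b - q = (1 - delta) (p - q0).  Since
    b >= (1 - delta) p, the second term is at most
    delta / (1 - delta) |p - phi|; since moreover q >= delta phi, the third is
    at most p |p - q0| / (delta phi).  The Cauchy-Schwarz inequality on the
    product of the law of the proposal with Lebesgue measure separates
    |p - q0|, which yields the root of the MISE, from f^2 p / phi.

    No conditional expectation is taken.  Conditioning on the proposal is
    expressed by an identity of measures ([joint_density]): the joint law of
    the conditioning variable V and of the sample Y has a density with respect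
    to (law of V) x (reference measure).  It is checked on rectangles, where it
    is the definition of conditional distribution and conditional independence
    ([cond_distribution_joint_density], [cond_independent_joint_density]), and
    extended by uniqueness of measures ([joint_density_rect]).  The moments are
    computed in [weighted_sample_expectation], [weighted_sample_uncorrelated]
    and [sample_mean_variance], and the second moment is bounded in
    [integral_sqr_ratio_mixture_le]. *)

(** * Measures with a density *)

Section density_measure.
Context d (T : measurableType d) (R : realType).
Variables (m : {measure set T -> \bar R}) (r : T -> R).
Hypotheses (mr : measurable_fun setT r) (r0 : forall x, 0 <= r x).
Local Open Scope ereal_scope.

Definition density_measure (A : set T) : \bar R := \int[m]_(x in A) (r x)%:E.

Let mE : measurable_fun setT (EFin \o r). Proof. exact/measurable_EFinP. Qed.

Let density_measure0 : density_measure set0 = 0.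
Proof. exact: integral_set0. Qed.

Let density_measure_ge0 A : 0 <= density_measure A.
Proof. by apply: integral_ge0 => x _; rewrite lee_fin. Qed.

Let density_measure_sigma_additive : semi_sigma_additive density_measure.
Proof.
by apply: (semi_sigma_additive_nng_induced mE) => x; rewrite lee_fin.
Qed.

HB.instance Definition _ := isMeasure.Build _ _ _ density_measure
  density_measure0 density_measure_ge0 density_measure_sigma_additive.

End density_measure.

Section change_of_density.
Import HBNNSimple.

(** The hypothesis says that the formula holds for indicators; simple functions
    follow by linearity and nonnegative functions by monotone convergence. *)
Lemma ge0_integral_density d (T : measurableType d) (R : realType)
    (nu m : {measure set T -> \bar R}) (r : T -> R) (h : T -> \bar R) :
  measurable_fun setT r -> (forall x, 0 <= r x) ->
  (forall A, measurable A -> nu A = density_measure m r A) ->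
  measurable_fun setT h -> (forall x, (0 <= h x)%E) ->
  (\int[nu]_x h x = \int[m]_x (h x * (r x)%:E))%E.
Proof.
move=> mr r0 nuE mh h0.
have mE : measurable_fun setT (EFin \o r) by exact/measurable_EFinP.
pose g := nnsfun_approx measurableT mh.
have g_ge0 n x : (0 <= (EFin \o g n) x)%E by rewrite lee_fin; exact: fun_ge0.
have g_nd x : nondecreasing_seq (fun n => (EFin \o g n) x).
  by move=> a b ab; rewrite lee_fin; exact/lefP/nd_nnsfun_approx.
have g_cvg x : (EFin \o g n) x @[n --> \oo] --> h x.
  exact: cvg_nnsfun_approx.
have mg n : measurable_fun setT (EFin \o g n) by exact/measurable_EFinP.
transitivity (limn (fun n => (\int[nu]_x (EFin \o g n) x)%E)).
  rewrite -monotone_convergence//.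
  by apply: eq_integral => x _; apply/esym/cvg_lim => //; exact: g_cvg.
transitivity (limn (fun n => (\int[m]_x ((EFin \o g n) x * (r x)%:E))%E)); last first.
  rewrite -monotone_convergence//; last 3 first.
  - by move=> n; exact: emeasurable_funM.
  - by move=> n x _; rewrite mule_ge0// lee_fin.
  - by move=> x _ a b ab; rewrite lee_wpmul2r ?lee_fin//; exact: g_nd.
  apply: eq_integral => x _; apply/cvg_lim => //; apply: cvgeZr; [by []|].
  exact: g_cvg.
congr (limn _); apply/funext => n.
have mi y : measurable_fun setT (fun x => (y * \1_(g n @^-1` [set y]) x)%:E).
  by apply/measurable_EFinP; exact: measurable_funM.
transitivity (\int[nu]_x (\sum_(y \in range (g n))
    (y * \1_(g n @^-1` [set y]) x)%:E))%E.
  by apply: eq_integral => x _; rewrite /= fimfunE -fsumEFin.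
rewrite ge0_integral_fsum//; last by move=> y x _; exact: nnfun_muleindic_ge0.
transitivity (\int[m]_x (\sum_(y \in range (g n))
    ((y * \1_(g n @^-1` [set y]) x)%:E * (r x)%:E)))%E; last first.
  apply: eq_integral => x _.
  rewrite -ge0_mule_fsuml => [|y]; last exact: nnfun_muleindic_ge0.
  by rewrite fsumEFin// -(fimfunE _ x).
rewrite ge0_integral_fsum//; last 2 first.
- by move=> y; exact: emeasurable_funM.
- by move=> y x _; rewrite mule_ge0 ?lee_fin//; exact: nnfun_muleindic_ge0.
apply: eq_fsbigr => y /[!inE] -[t _ <-]; set y0 := g n t.
have y0_ge0 : (0 <= y0)%R by exact: fun_ge0.
have mA : measurable (g n @^-1` [set y0]) by exact: measurable_sfunP.
under eq_integral do rewrite EFinM.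
rewrite ge0_integralZl_EFin//; last exact/measurable_EFinP.
rewrite integral_indic// setIT nuE//.
under [RHS]eq_integral do rewrite EFinM -muleA.
rewrite ge0_integralZl_EFin//; last 2 first.
- by move=> x _; rewrite mule_ge0// lee_fin.
- by apply: emeasurable_funM => //; exact/measurable_EFinP.
congr (_ * _)%E; rewrite /density_measure integral_mkcond.
by apply: eq_integral => x _; rewrite patchE indicE; case: ifPn; rewrite ?mul1e ?mul0e.
Qed.

End change_of_density.

Lemma integral_density d (T : measurableType d) (R : realType)
    (nu m : {measure set T -> \bar R}) (r h : T -> R) :
  measurable_fun setT r -> (forall x, 0 <= r x) ->
  (forall A, measurable A -> nu A = density_measure m r A) ->
  measurable_fun setT h ->
  (\int[nu]_x (h x)%:E = \int[m]_x (h x * r x)%:E)%E.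
Proof.
move=> mr r0 nuE mh; rewrite [LHS]integralE [RHS]integralE.
have mhE : measurable_fun setT (EFin \o h) by exact/measurable_EFinP.
congr (_ - _)%E.
- rewrite (ge0_integral_density mr r0 nuE)//; last exact: measurable_funepos.
  apply: eq_integral => x _; rewrite !funeposE -!EFin_max -EFinM.
  by rewrite maxr_pMl ?mul0r.
- rewrite (ge0_integral_density mr r0 nuE)//; last exact: measurable_funeneg.
  apply: eq_integral => x _; rewrite !funenegE -!EFinN -!EFin_max -EFinM.
  by rewrite maxr_pMl ?mul0r ?mulNr.
Qed.

(** * Integrals and measurability on products *)

Lemma ge0_integral_prod_rect d1 d2 (T1 : measurableType d1)
    (T2 : measurableType d2) (R : realType)
    (m1 : {sigma_finite_measure set T1 -> \bar R})
    (m2 : {sigma_finite_measure set T2 -> \bar R})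
    (h : T1 * T2 -> \bar R) (A : set T1) (B : set T2) :
  measurable A -> measurable B ->
  measurable_fun setT h -> (forall z, (0 <= h z)%E) ->
  (\int[m1 \x m2]_(z in A `*` B) h z =
   \int[m1]_(x in A) \int[m2]_(y in B) h (x, y))%E.
Proof.
move=> mA mB mh h0.
have mAB : measurable (A `*` B) by exact: measurableX.
rewrite integral_mkcond fubini_tonelli1; last 2 first.
- by apply: (iffLR (measurable_restrictT h mAB)); exact: measurable_funTS.
- by move=> z; exact: erestrict_ge0.
rewrite [RHS]integral_mkcond; apply: eq_integral => x _.
rewrite /fubini_F [RHS]patchE; case: ifPn => xA.
  rewrite [RHS]integral_mkcond; apply: eq_integral => y _.
  by rewrite !patchE in_setX/= xA.
by rewrite integral0_eq// => y _; rewrite patchE in_setX/= (negPf xA).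
Qed.

Lemma ge0_integral_snd d1 d2 (T1 : measurableType d1) (T2 : measurableType d2)
    (R : realType) (m1 : probability T1 R)
    (m2 : {sigma_finite_measure set T2 -> \bar R}) (h : T2 -> \bar R) :
  measurable_fun setT h -> (forall z, (0 <= h z)%E) ->
  (\int[m1 \x m2]_z h z.2 = \int[m2]_y h y)%E.
Proof.
move=> mh h0; rewrite fubini_tonelli2//=; last first.
  by apply: measurableT_comp.
apply: eq_integral => y _; rewrite /fubini_G/=.
by rewrite integral_cst// [X in (_ * X)%E](probability_setT m1) mule1.
Qed.

(** For a fixed first factor setT, the sets B with setT x B in the right-hand
    side form a sigma-algebra containing C; every rectangle A x B is the
    intersection of A x setT and setT x B. *)
Lemma measurable_prod_gen d1 d2 (T1 : measurableType d1) (T2 : measurableType d2)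
    (C : set (set T2)) :
  @measurable _ T2 = <<s C >> -> C setT ->
  @measurable _ (T1 * T2)%type = <<s [set A `*` B | A in measurable & B in C] >>.
Proof.
move=> mC CT; rewrite measurable_prod_measurableType.
apply/seteqP; split; last first.
  apply: sub_sigma_algebra2 => _ [A mA [B CB <-]]; exists A => //; exists B => //.
  by rewrite mC; exact: sub_sigma_algebra.
apply: smallest_sub; first exact: smallest_sigma_algebra.
move=> _ [A mA [B mB <-]].
have -> : A `*` B = (A `*` setT) `&` (setT `*` B) by rewrite -setXI setIT setTI.
set S := <<s _ >>; have sS : sigma_algebra setT S by exact: smallest_sigma_algebra.
pose U := g_sigma_algebraType [set A `*` B | A in @measurable _ T1 & B in C].
suff : @measurable _ U (setT `*` B).
  move=> mTB; apply: (@measurableI _ U) => //.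
  by apply: sub_sigma_algebra; exists A => //; exists setT.
move: B mB; rewrite mC; apply: smallest_sub.
  split => /=.
  - by rewrite setX0; exact: (@measurable0 _ U).
  - move=> B mB; rewrite setTD.
    rewrite (_ : _ `*` ~` B = ~` (setT `*` B)); first exact: (@measurableC _ U).
    by apply/seteqP; split => -[a b] /=; tauto.
  - move=> F mF; rewrite (_ : _ `*` _ = \bigcup_k (setT `*` F k)).
      exact: (@bigcup_measurable _ U).
    by rewrite setX_bigcupr.
by move=> B CB; apply: sub_sigma_algebra; exists setT => //; exists B.
Qed.

Section sigma_finite_product.
Context d1 d2 (T1 : measurableType d1) (T2 : measurableType d2) (R : realType).
Variables (m1 : {sigma_finite_measure set T1 -> \bar R})
  (m2 : {sigma_finite_measure set T2 -> \bar R}).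

(** The product measure under a name of its own, so that it carries its
    sigma-finite structure and can serve again as a factor in a product. *)
Definition sigma_finite_prod : set (T1 * T2) -> \bar R := (m1 \x m2)%E.

HB.instance Definition _ := Measure.copy sigma_finite_prod (m1 \x m2)%E.

Let sigma_finite_prod_sigma_finite : sigma_finite setT sigma_finite_prod.
Proof.
have /sigma_finiteP[F [Fcov ndF Ffin]] := sigma_finiteT m1.
have /sigma_finiteP[G [Gcov ndG Gfin]] := sigma_finiteT m2.
exists (fun k => F k `*` G k).
  apply/seteqP; split => // -[x y] _.
  have [i _ Fi] : (\bigcup_i F i) x by rewrite -Fcov.
  have [j _ Gj] : (\bigcup_i G i) y by rewrite -Gcov.
  exists (maxn i j) => //; split => /=.
    by have /subsetPset := ndF _ _ (leq_maxl i j); exact.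
  by have /subsetPset := ndG _ _ (leq_maxr i j); exact.
move=> k; have [mF Fk] := Ffin k; have [mG Gk] := Gfin k; split.
  exact: measurableX.
by rewrite /sigma_finite_prod product_measure1E// lte_mul_pinfty// ge0_fin_numE.
Qed.

HB.instance Definition _ :=
  Measure_isSigmaFinite.Build _ _ _ sigma_finite_prod sigma_finite_prod_sigma_finite.

End sigma_finite_product.

Lemma integral_prodM d1 d2 (T1 : measurableType d1) (T2 : measurableType d2)
    (R : realType) (m1 : {sigma_finite_measure set T1 -> \bar R})
    (m2 : {sigma_finite_measure set T2 -> \bar R}) (g1 : T1 -> R) (g2 : T2 -> R) :
  m1.-integrable setT (EFin \o g1) -> m2.-integrable setT (EFin \o g2) ->
  (\int[m1 \x m2]_z (g1 z.1 * g2 z.2)%:E =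
   (\int[m1]_x (g1 x)%:E) * (\int[m2]_y (g2 y)%:E))%E.
Proof.
move=> ig1 ig2.
have mg1 : measurable_fun setT g1.
  by apply/measurable_EFinP; exact: measurable_int ig1.
have mg2 : measurable_fun setT g2.
  by apply/measurable_EFinP; exact: measurable_int ig2.
have mg : measurable_fun setT (fun z : T1 * T2 => (g1 z.1 * g2 z.2)%:E).
  apply/measurable_EFinP; apply: measurable_funM; exact: measurableT_comp.
have fing2 := integrable_fin_num measurableT ig2.
rewrite -integral12_prod_meas1; last first.
  apply/(integrable12ltyP _ _ mg) => /=.
  have ig2' := integrable_fin_num measurableT (integrable_abse ig2).
  rewrite (eq_integral (fun x => `|(g1 x)%:E| * \int[m2]_y `|(g2 y)%:E|)%E).
    rewrite ge0_integralZr//; last 2 first.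
    - by do 2 apply: measurableT_comp => //.
    - by apply: integral_ge0.
    rewrite -(fineK ig2') -(fineK (integrable_fin_num measurableT (integrable_abse ig1))).
    by rewrite -EFinM ltry.
  move=> x _; rewrite -ge0_integralZl_EFin//; last by do 2 apply: measurableT_comp => //.
  by apply: eq_integral => y _; rewrite -EFinM -normrM.
rewrite (eq_integral (fun x => (fine (\int[m2]_y (g2 y)%:E))%:E * (g1 x)%:E)%E).
  by rewrite integralZl// fineK// muleC.
by move=> x _; rewrite fineK// muleC -integralZl.
Qed.

(** * Samples with a density given a random environment *)

Lemma measurable_funV_gt0 d (T : measurableType d) (R : realType) (f : T -> R) :
  measurable_fun setT f -> (forall x, 0 < f x) ->
  measurable_fun setT (fun x => (f x)^-1).
Proof.
move=> mf f0; rewrite (_ : (fun _ => _) = (@powR R ^~ (-1)) \o f).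
  by apply: measurableT_comp.
by apply/funext => x /=; rewrite powR_inv1// ltW.
Qed.

Section joint_density.
Context d d1 d2 (Om : measurableType d) (E : measurableType d1)
  (S : measurableType d2) (R : realType).
Variables (Pr : probability Om R) (la : {sigma_finite_measure set S -> \bar R}).
Variables (V : {RV Pr >-> E}) (Y : {RV Pr >-> S}) (r : E * S -> R).

(** The law of (V, Y) is r times (law of V) x la; that is, Y has density
    r (V, .) with respect to la conditionally on V. *)
Definition joint_density : Prop := forall h : E * S -> \bar R,
  measurable_fun setT h -> (forall z, (0 <= h z)%E) ->
  (\int[Pr]_w h (V w, Y w) =
   \int[distribution Pr V \x la]_z (h z * (r z)%:E))%E.

Lemma measurable_joint : measurable_fun setT (fun w => (V w, Y w)).
Proof. by apply: measurable_fun_pair; exact: measurable_funP. Qed.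

Hypotheses (mr : measurable_fun setT r) (r0 : forall z, 0 < r z).

(** Both sides define finite measures on E x S, and the sets B x D with D in
    the pi-system C generate the product sigma-algebra.  The freedom in the
    choice of C lets S itself be a product. *)
Lemma joint_density_rect (C : set (set S)) :
  @measurable _ S = <<s C >> -> setI_closed C -> C setT ->
  (forall B D, measurable B -> C D ->
    Pr (V @^-1` B `&` Y @^-1` D) =
    \int[Pr]_(w in V @^-1` B) \int[la]_(y in D) (r (V w, y))%:E)%E ->
  joint_density.
Proof.
move=> mC CI CT PrE h mh h0.
have r0' z : 0 <= r z by exact: ltW.
have mrE : measurable_fun setT (EFin \o r) by exact/measurable_EFinP.
have rE0 z : (0 <= (EFin \o r) z)%E by rewrite lee_fin.
have mVY := measurable_joint.
pose XY : {mfun Om >-> (E * S)%type} := HB.pack (fun w => (V w, Y w))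
  (isMeasurableFun.Build _ _ _ _ _ mVY).
rewrite -(ge0_integral_density (nu := distribution Pr XY) mr r0' _ mh h0).
  by rewrite ge0_integral_distribution.
pose G := [set A `*` B | A in @measurable _ E & B in C].
apply: (@measure_unique _ _ _ G (fun=> setT)).
- exact: measurable_prod_gen.
- move=> _ _ [A1 mA1 [B1 CB1 <-]] [A2 mA2 [B2 CB2 <-]].
  rewrite -setXI; exists (A1 `&` A2); first exact: measurableI.
  by exists (B1 `&` B2) => //; exact: CI.
- by move=> _; exists setT => //; exists setT => //; rewrite setXTT.
- by rewrite bigcup_const//; exists 0%N.
- move=> _ [B mB [D CD <-]].
  have mD : measurable D by rewrite mC; exact: sub_sigma_algebra.
  transitivity (Pr (V @^-1` B `&` Y @^-1` D)) => //.
  rewrite PrE// -[RHS]/(\int[distribution Pr V \x la]_(z in B `*` D) (EFin \o r) z)%E.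
  rewrite ge0_integral_prod_rect//.
  rewrite ge0_integral_pushforward//.
  + have -> : (fun x => \int[la]_(y in D) (r (x, y))%:E)%E =
        fubini_F la ((EFin \o r) \_ (setT `*` D)).
      apply/funext => x; rewrite /fubini_F [LHS]integral_mkcond.
      by apply: eq_integral => y _; rewrite !patchE in_setX/= in_setT.
    apply: measurable_funTS; apply: measurable_fun_fubini_tonelli_F => /=.
      have mTD : measurable (setT `*` D : set (E * S)) by exact: measurableX.
      apply: (iffLR (measurable_restrictT (EFin \o r) mTD)).
      exact: measurable_funTS.
    by move=> z; exact: erestrict_ge0.
  + by move=> x _; apply: integral_ge0 => y _; rewrite lee_fin.
- by move=> _; rewrite /= probability_setT ltry.
Qed.

Hypothesis VY : joint_density.

(** Dividing by r cancels the density of Y; what is left depends on the second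
    coordinate only, and the law of V integrates to 1. *)
Lemma ge0_integral_importance (g : S -> R) :
  measurable_fun setT g -> (forall y, 0 <= g y) ->
  (\int[Pr]_w (g (Y w) / r (V w, Y w))%:E = \int[la]_y (g y)%:E)%E.
Proof.
move=> mg g0.
have mr' : measurable_fun setT (fun z : E * S => g z.2 / r z).
  apply: measurable_funM; first exact: measurableT_comp.
  exact: measurable_funV_gt0.
rewrite (@VY (fun z => (g z.2 / r z)%:E)); last 2 first.
- exact/measurable_EFinP.
- by move=> z; rewrite lee_fin divr_ge0// ltW.
rewrite -(ge0_integral_snd (distribution Pr V) la (h := EFin \o g)); last 2 first.
- exact/measurable_EFinP.
- by move=> z; rewrite lee_fin.
by apply: eq_integral => z _; rewrite -EFinM divfK// gt_eqF.
Qed.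

Lemma integral_importance (g : S -> R) : measurable_fun setT g ->
  (\int[Pr]_w (g (Y w) / r (V w, Y w))%:E = \int[la]_y (g y)%:E)%E.
Proof.
move=> mg; rewrite [LHS]integralE [RHS]integralE.
have mgp : measurable_fun setT (fun y => Num.max (g y) 0).
  exact: measurable_maxr.
have mgn : measurable_fun setT (fun y => Num.max (- g y) 0).
  by apply: measurable_maxr => //; exact: measurableT_comp.
have gp0 y : 0 <= Num.max (g y) 0 by rewrite le_max lexx orbT.
have gn0 y : 0 <= Num.max (- g y) 0 by rewrite le_max lexx orbT.
congr (_ - _)%E.
- transitivity (\int[la]_y (Num.max (g y) 0)%:E)%E.
    rewrite -ge0_integral_importance//; apply: eq_integral => w _.
    by rewrite funeposE -EFin_max maxr_pMl ?mul0r// invr_ge0 ltW.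
  by apply: eq_integral => y _; rewrite funeposE EFin_max.
- transitivity (\int[la]_y (Num.max (- g y) 0)%:E)%E.
    rewrite -ge0_integral_importance//; apply: eq_integral => w _.
    by rewrite funenegE -EFinN -EFin_max maxr_pMl ?mul0r ?mulNr// invr_ge0 ltW.
  by apply: eq_integral => y _; rewrite funenegE EFin_max.
Qed.

End joint_density.

(** * Second moments of uncorrelated sums *)

Section second_moments.
Context d (T : measurableType d) (R : realType).
Local Open Scope ereal_scope.

Lemma Lnorm2E (m : {measure set T -> \bar R}) (f : T -> R) :
  'N[m]_2%:E[EFin \o f] = sqrte (\int[m]_x (f x ^+ 2)%:E).
Proof.
rewrite unlock/= -poweR12_sqrt; last first.
  by apply: integral_ge0 => x _; rewrite lee_fin sqr_ge0.
congr (_ `^ _); apply: eq_integral => x _ /=.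
by rewrite powR_mulrn// real_normK// num_real.
Qed.

Lemma sqrte_lty (x : \bar R) : (sqrte x < +oo) = (x < +oo).
Proof. by case: x => [r| |] /=; rewrite ?ltry ?ltNyr ?ltNyy. Qed.

Lemma Lfun2_sqr_lty (m : {measure set T -> \bar R}) (f : T -> R) :
  measurable_fun setT f -> \int[m]_x (f x ^+ 2)%:E < +oo ->
  f \in Lfun m 2%:E.
Proof.
move=> mf foo; rewrite inE; apply/andP; split; rewrite inE//=.
by rewrite /finite_norm Lnorm2E sqrte_lty.
Qed.

Variable P : probability T R.

Lemma covariance_sumr (I : eqType) (s : seq I) (X : T -> R) (W : I -> T -> R) :
  X \in Lfun P 2%:E -> (forall i, i \in s -> W i \in Lfun P 2%:E) ->
  covariance P X (\sum_(i <- s) W i)%R = \sum_(i <- s) covariance P X (W i).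
Proof.
move=> X2; elim: s => [|x s IHs] W2; first by rewrite !big_nil covariance_cst_r.
have W2s i : i \in s -> W i \in Lfun P 2%:E.
  by move=> si; apply: W2; rewrite inE si orbT.
rewrite !big_cons covarianceDr//; first by rewrite IHs.
- by apply: W2; rewrite mem_head.
- by rewrite big_seq rpred_sum// lee1n.
Qed.

Lemma variance_sum_uncorrelated (I : eqType) (s : seq I) (W : I -> T -> R) :
  uniq s -> (forall i, i \in s -> W i \in Lfun P 2%:E) ->
  (forall i j, i != j -> covariance P (W i) (W j) = 0) ->
  'V_P[(\sum_(i <- s) W i)%R] = \sum_(i <- s) 'V_P[W i].
Proof.
elim: s => [|x s IHs] /=; first by rewrite !big_nil variance_cst.
move=> /andP[xs us] W2 W0.
have W2s i : i \in s -> W i \in Lfun P 2%:E.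
  by move=> si; apply: W2; rewrite inE si orbT.
have W2x : W x \in Lfun P 2%:E by apply: W2; rewrite mem_head.
rewrite !big_cons varianceD//; last by rewrite big_seq rpred_sum// lee1n.
have -> : covariance P (W x) (\sum_(i <- s) W i)%R = 0.
  rewrite covariance_sumr// big_seq big1// => i si.
  by apply: W0; apply: contraNneq xs => ->.
by rewrite IHs// mule0 adde0.
Qed.

(** The variance of |X - c| is nonnegative, so (E |X - c|)^2 <= E |X - c|^2,
    and the latter is the variance of X. *)
Lemma expectation_abs_dev_le (X : T -> R) (c : R) : X \in Lfun P 2%:E ->
  'E_P[X] = c%:E -> 'E_P[(fun w => `|X w - c|)%R] <= sqrte 'V_P[X].
Proof.
move=> X2 EX; pose U := (fun w => `|X w - c|)%R.
have X'2 : (X - cst c)%R \in Lfun P 2%:E.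
  have c2 : cst c \in Lfun P 2%:E := Lfun_cst P c 2.
  by apply: rpredB => //; exact: lee1n.
have U_sqr : (U ^+ 2)%R = ((X \- cst c) ^+ 2)%R.
  by apply/funext => w; rewrite !fctE /U real_normK// num_real.
have mX' : measurable_fun setT (X \- cst c)%R.
  by move: X'2; rewrite inE => /andP[/[!inE]/=].
have U2 : U \in Lfun P 2%:E.
  apply: Lfun2_sqr_lty; first exact: measurableT_comp.
  have := integrable_lty measurableT (Lfun2_integrable_sqr X'2).
  apply: le_lt_trans; rewrite le_eqVlt; apply/orP; left; apply/eqP.
  by apply: eq_integral => w _ /=; rewrite /U real_normK// num_real.
have VX : 'V_P[X] = 'E_P[(U ^+ 2)%R].
  by rewrite U_sqr /variance covariance.unlock EX/= expr2.
have EU0 : 0 <= 'E_P[U] by apply: expectation_ge0 => w; rewrite /U.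
have := variance_ge0 P U; rewrite varianceE// -VX.
rewrite sube_ge0; last first.
  rewrite -[_ ^+ 2]/(_ * _) fin_numM// expectation_fin_num//.
  - by apply: Lfun_subset12 => //; rewrite fin_num_measure.
  - by apply: Lfun_subset12 => //; rewrite fin_num_measure.
move=> EUV.
have : sqrte ('E_P[U] ^+ 2) <= sqrte 'V_P[X] by rewrite lee_sqrt ?variance_ge0.
by rewrite sqrte_sqr gee0_abs.
Qed.

End second_moments.

(** * Importance sampling from a random proposal *)

Section importance_sampling.
Context d d1 d2 (Om : measurableType d) (E : measurableType d1)
  (T : measurableType d2) (R : realType) (n : nat).
Variables (Pr : probability Om R) (la : {sigma_finite_measure set T -> \bar R}).
Variables (V : {RV Pr >-> E}) (X : 'I_n -> {RV Pr >-> T}).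

Definition pair_RV (i j : 'I_n) : {RV Pr >-> (T * T)%type} :=
  HB.pack (fun w => (X i w, X j w))
    (isMeasurableFun.Build _ _ _ _ _ (measurable_joint (X i) (X j))).

Variables (q : E * T -> R) (g : T -> R).
Hypotheses (mq : measurable_fun setT q) (q0 : forall z, 0 < q z).
Hypothesis ig : la.-integrable setT (EFin \o g).

(** The density of a pair of samples that are independent given V. *)
Definition prod_density (z : E * (T * T)) := q (z.1, z.2.1) * q (z.1, z.2.2).

Hypothesis X1 : forall i, joint_density la V (X i) q.
Hypothesis X2 : forall i j, i != j ->
  joint_density (sigma_finite_prod la la) V (pair_RV i j) prod_density.

Definition weighted_sample (i : 'I_n) (w : Om) : R :=
  g (X i w) / q (V w, X i w).

Definition second_moment : \bar R :=
  (\int[distribution Pr V \x la]_z (g z.2 ^+ 2 / q z)%:E)%E.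

Hypothesis M2 : (second_moment < +oo)%E.

Let I := \int[la]_x g x.

Let mg : measurable_fun setT g.
Proof. by apply/measurable_EFinP; exact: measurable_int ig. Qed.

Let IE : (\int[la]_x (g x)%:E = I%:E)%E.
Proof. by rewrite /I /Rintegral fineK//; exact: integrable_fin_num ig. Qed.

Let mW z : measurable_fun setT (weighted_sample z).
Proof.
rewrite (_ : weighted_sample z =
    (fun z => g z.2 / q z) \o (fun w => (V w, X z w)))//.
apply: measurableT_comp; last exact: measurable_joint.
apply: measurable_funM; first exact: measurableT_comp.
exact: measurable_funV_gt0.
Qed.

Lemma measurable_prod_density : measurable_fun setT prod_density.
Proof.
apply: measurable_funM.
- apply: (@measurableT_comp _ _ _ _ _ _ q _ (fun z => (z.1, z.2.1)) mq).
  by apply: measurable_fun_pair => //; exact: measurableT_comp.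
- apply: (@measurableT_comp _ _ _ _ _ _ q _ (fun z => (z.1, z.2.2)) mq).
  by apply: measurable_fun_pair => //; exact: measurableT_comp.
Qed.

Lemma weighted_sample_sqr i :
  (\int[Pr]_w (weighted_sample i w ^+ 2)%:E = second_moment)%E.
Proof.
rewrite (@X1 i (fun z => ((g z.2 / q z) ^+ 2)%:E)); last 2 first.
- apply/measurable_EFinP; apply: measurable_funX.
  apply: measurable_funM; first exact: measurableT_comp.
  exact: measurable_funV_gt0.
- by move=> z; rewrite lee_fin sqr_ge0.
apply: eq_integral => z _; rewrite -EFinM; congr EFin.
by have qz0 : q z != 0; [rewrite gt_eqF|field].
Qed.

Lemma weighted_sample_Lfun2 i : weighted_sample i \in Lfun Pr 2%:E.
Proof. by apply: Lfun2_sqr_lty => //; rewrite weighted_sample_sqr. Qed.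

Lemma weighted_sample_Lfun1 i : weighted_sample i \in Lfun Pr 1.
Proof.
apply: Lfun_subset12; last exact: weighted_sample_Lfun2.
exact: fin_num_measure.
Qed.

Lemma weighted_sample_expectation i : ('E_Pr[weighted_sample i] = I%:E)%E.
Proof. by rewrite unlock (integral_importance mq q0 (@X1 i)). Qed.

Lemma weighted_sample_variance i :
  ('V_Pr[weighted_sample i] = second_moment - (I ^+ 2)%:E)%E.
Proof.
rewrite varianceE ?weighted_sample_Lfun2// weighted_sample_expectation.
by rewrite -EFin_expe -(weighted_sample_sqr i) unlock.
Qed.

(** Given V the two weights are independent with the same nonrandom mean I, so
    sharing the proposal creates no correlation. *)
Lemma weighted_sample_uncorrelated i j : i != j ->
  covariance Pr (weighted_sample i) (weighted_sample j) = 0%E.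
Proof.
move=> ij; rewrite covarianceE ?weighted_sample_Lfun1//; last first.
  by apply: Lfun2_mul_Lfun1; exact: weighted_sample_Lfun2.
rewrite !weighted_sample_expectation.
have prod_gt0 z : 0 < prod_density z by rewrite /prod_density mulr_gt0.
have mgg : measurable_fun setT (fun y : T * T => g y.1 * g y.2).
  by apply: measurable_funM; exact: measurableT_comp.
have := integral_importance measurable_prod_density prod_gt0 (X2 ij) mgg.
rewrite [RHS]integral_prodM// IE => EW.
rewrite unlock [X in (X - _)%E](_ : _ = (I%:E * I%:E)%E).
  by rewrite subee.
rewrite -EW; apply: eq_integral => w _ /=.
by rewrite /weighted_sample /prod_density/= invfM mulrACA.
Qed.

Definition sample_mean (w : Om) : R := n%:R^-1 * \sum_(i < n) weighted_sample i w.

Hypothesis n0 : (0 < n)%N.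

Let sample_meanE : sample_mean =
  n%:R^-1 \o* (\sum_(i <- index_enum 'I_n) weighted_sample i).
Proof. by apply/funext => w; rewrite /sample_mean/= fct_sumE mulrC. Qed.

Let sum_Lfun2 : \sum_(i <- index_enum 'I_n) weighted_sample i \in Lfun Pr 2%:E.
Proof.
have W2 i : xpredT i -> weighted_sample i \in Lfun Pr 2%:E.
  by move=> _; exact: weighted_sample_Lfun2.
by rewrite rpred_sum// lee1n.
Qed.

Lemma sample_mean_Lfun2 : sample_mean \in Lfun Pr 2%:E.
Proof. by rewrite sample_meanE Lfun_scale// ler1n. Qed.

Lemma sample_mean_expectation : ('E_Pr[sample_mean] = I%:E)%E.
Proof.
rewrite sample_meanE expectationZl; last first.
  by apply: Lfun_subset12 => //; exact: fin_num_measure.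
rewrite -(big_map weighted_sample xpredT id) expectation_sum; last first.
  by move=> _ /mapP[i _ ->]; exact: weighted_sample_Lfun1.
rewrite big_map; under eq_bigr do rewrite weighted_sample_expectation.
rewrite sumEFin sumr_const card_ord -EFinM -[I *+ n]mulr_natl mulrA mulVf ?mul1r//.
by rewrite pnatr_eq0 -lt0n.
Qed.

Lemma sample_mean_variance :
  ('V_Pr[sample_mean] = (second_moment - (I ^+ 2)%:E) * (n%:R^-1)%:E)%E.
Proof.
rewrite sample_meanE varianceZ// variance_sum_uncorrelated ?index_enum_uniq//; last 2 first.
- by move=> i _; exact: weighted_sample_Lfun2.
- by move=> i j ij; exact: weighted_sample_uncorrelated.
under eq_bigr do rewrite weighted_sample_variance.
have M2fin : second_moment \is a fin_num.
  rewrite ge0_fin_numE//; apply: integral_ge0 => z _.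
  by rewrite lee_fin divr_ge0 ?sqr_ge0// ltW.
rewrite -(fineK M2fin) -EFinB sumEFin sumr_const card_ord -!EFinM; congr EFin.
rewrite -[(_ - _) *+ n]mulr_natl; have : n%:R != 0 :> R by rewrite pnatr_eq0 -lt0n.
by move=> n0'; field.
Qed.

End importance_sampling.

(** * Conditional distributions as joint densities *)

Section conditioning_joint_density.
Context d d2 (Om : measurableType d) (T : measurableType d2) (R : realType).
Variables (Pr : probability Om R) (la : {sigma_finite_measure set T -> \bar R}).
Variable G : set (set Om).
Hypotheses (sG : sigma_algebra setT G) (Gm : G `<=` measurable).

Let E := g_sigma_algebraType G.

Let mEG (B : set E) : measurable B -> G B.
Proof. by rewrite measurable_g_measurableTypeE. Qed.

Let midG : measurable_fun setT (id : Om -> E).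
Proof. by move=> _ B /mEG GB; rewrite setTI preimage_id; exact: Gm. Qed.

(** The sigma-algebra G as a random variable: the identity onto the same space
    equipped with G, so that events of G are the preimages under it. *)
Definition id_RV : {RV Pr >-> E} :=
  HB.pack (id : Om -> E) (isMeasurableFun.Build _ _ _ _ _ midG).

Let measurable_id_RV d' (U : measurableType d') (h : E -> U) :
  measurable_fun setT h -> measurable_fun setT (h : Om -> U).
Proof. by move=> mh; exact: (measurableT_comp mh midG). Qed.

Variables (Q : Om -> probability T R) (q : E * T -> R).
Hypotheses (mq : measurable_fun setT q) (q0 : forall z, 0 < q z).
Hypothesis Qq : {ae Pr, forall w A, measurable A ->
  Q w A = (\int[la]_(x in A) (q (w, x))%:E)%E}.

Let mqE : measurable_fun setT (EFin \o q). Proof. exact/measurable_EFinP. Qed.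

Let qE0 z : (0 <= (EFin \o q) z)%E. Proof. by rewrite lee_fin ltW. Qed.

Let mq_in (D : set T) : measurable D ->
  measurable_fun setT (fun w : E => (\int[la]_(x in D) (q (w, x))%:E)%E).
Proof.
move=> mD; have -> : (fun w : E => (\int[la]_(x in D) (q (w, x))%:E)%E) =
    fubini_F la ((EFin \o q) \_ (setT `*` D)).
  apply/funext => x; rewrite /fubini_F [LHS]integral_mkcond.
  by apply: eq_integral => y _; rewrite !patchE in_setX/= in_setT.
have mTD : measurable (setT `*` D : set (E * T)) by exact: measurableX.
apply: measurable_fun_fubini_tonelli_F.
  apply: (iffLR (measurable_restrictT (EFin \o q) mTD)).
  exact: measurable_funTS.
by move=> z; exact: erestrict_ge0.
Qed.

Lemma cond_distribution_joint_density (X : {RV Pr >-> T}) :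
  cond_distribution G X Q -> joint_density la id_RV X q.
Proof.
move=> XQ; apply: (joint_density_rect mq q0 (C := measurable)) => //.
- by rewrite sigma_algebra_id//; exact: sigma_algebra_measurable.
- exact: measurableI.
move=> B D mB mD; have GB : G B := mEG mB.
have [mQ QE] := XQ _ mD.
rewrite setIC -QE//; apply: ge0_ae_eq_integral => //.
- exact: Gm.
- by apply: measurable_funTS; apply: measurable_id_RV.
- by apply: measurable_funTS; apply: measurable_id_RV; exact: mq_in.
- by move=> w _; apply: integral_ge0 => x _; rewrite lee_fin ltW.
- by apply: filterS Qq => w Qw _; exact: Qw.
Qed.

(** Conditional independence of the whole family is applied to the events
    X_i in A1, X_j in A2 and X_k in setT for the other k, whose conditional
    probabilities are 1. *)
Lemma cond_independent_joint_density n (X : 'I_n -> {RV Pr >-> T}) i j :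
  cond_independent G X -> (forall i, cond_distribution G (X i) Q) -> i != j ->
  joint_density (sigma_finite_prod la la) id_RV (pair_RV X i j) (prod_density q).
Proof.
move=> XI XQ ij.
have mqq := measurable_prod_density mq.
have qq0 z : 0 < prod_density q z by rewrite mulr_gt0.
apply: (joint_density_rect mqq qq0
  (C := [set A `*` B | A in measurable & B in measurable])).
- exact: measurable_prod_measurableType.
- move=> _ _ [A1 mA1 [B1 mB1 <-]] [A2 mA2 [B2 mB2 <-]].
  by rewrite -setXI; exists (A1 `&` A2); [exact: measurableI|
    exists (B1 `&` B2) => //; exact: measurableI].
- by exists setT => //; exists setT => //; rewrite setXTT.
move=> B _ mB [A1 mA1 [A2 mA2 <-]]; have GB : G B := mEG mB.
pose A k := if k == i then A1 else if k == j then A2 else setT.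
have mA k : measurable (A k) by rewrite /A; case: ifP => // _; case: ifP.
have prodQ w : (\prod_(k < n) Q w (A k) = Q w A1 * Q w A2)%E.
  rewrite (bigD1 i)//= (bigD1 j)/=; last by rewrite eq_sym.
  rewrite big1 ?mule1; last first.
    move=> k /andP[/negPf ki /negPf kj]; rewrite /A ki kj.
    exact: probability_setT.
  by rewrite /A !eqxx eq_sym (negPf ij).
have [mg gE] := XI A (fun k w => Q w (A k)) mA (fun k => XQ k _ (mA k)).
have XA : [set w | forall k, A k (X k w)] = pair_RV X i j @^-1` (A1 `*` A2).
  apply/seteqP; split => w /=.
    move=> Aw; have := Aw i; have := Aw j.
    by rewrite /A !eqxx eq_sym (negPf ij) => ? ?; split.
  by move=> [XA1 XA2] k; rewrite /A; case: eqP => [->//|_]; case: eqP => [->|].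
rewrite setIC -XA -gE//.
have prodq w : (\int[sigma_finite_prod la la]_(y in A1 `*` A2) (prod_density q (w, y))%:E =
    (\int[la]_(x in A1) (q (w, x))%:E) * (\int[la]_(x in A2) (q (w, x))%:E))%E.
  have mqw : measurable_fun setT (fun x => (q (w, x))%:E).
    by apply/measurable_EFinP; exact: measurableT_comp.
  have mqqw : measurable_fun setT (fun y => (prod_density q (w, y))%:E).
    by apply/measurable_EFinP; exact: measurableT_comp.
  have mqwA D : measurable_fun D (fun x => (q (w, x))%:E) by exact: measurable_funTS.
  rewrite [LHS]ge0_integral_prod_rect//; last by move=> y; rewrite lee_fin ltW.
  rewrite -ge0_integralZr//; last 2 first.
  - by move=> x _; rewrite lee_fin ltW.
  - by apply: integral_ge0 => x _; rewrite lee_fin ltW.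
  apply: eq_integral => x _; rewrite -ge0_integralZl_EFin//; last first.
  - exact: ltW.
  - by move=> y _; rewrite lee_fin ltW.
rewrite /=; under [RHS]eq_integral do rewrite prodq.
apply: ge0_ae_eq_integral => //.
- exact: Gm.
- by apply: measurable_funTS; apply: measurable_id_RV.
- apply: measurable_funTS; apply: measurable_id_RV.
  by apply: emeasurable_funM; exact: mq_in.
- by move=> w _; rewrite prodQ mule_ge0.
- by move=> w _; rewrite mule_ge0//; apply: integral_ge0 => x _; rewrite lee_fin ltW.
- by apply: filterS Qq => w Qw _; rewrite prodQ !Qw.
Qed.

End conditioning_joint_density.

(** * The second moment for a defensive mixture *)

(** With q the mixture in the denominator and b := (1 - delta) p + delta phi,
    p^2 / q = p + p (p - b) / b + p^2 (b - q) / (b q).  The detour through b is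
    needed for the last coefficient: p / q has no bound in terms of delta,
    whereas p / b <= 1 / (1 - delta). *)
Lemma sqr_ratio_mixture_le (R : realFieldType) (delta p phi q0 : R) :
  0 < delta < 1 -> 0 < p -> 0 < phi -> 0 <= q0 ->
  p ^+ 2 / ((1 - delta) * q0 + delta * phi) <=
  p + delta^-1 * `|(q0 - p) * (p / phi)| + delta / (1 - delta) * `|p - phi|.
Proof.
move=> /andP[d0 d1] p0 phi0 q00.
have d1' : 0 < 1 - delta by rewrite subr_gt0.
set q := (1 - delta) * q0 + delta * phi.
pose b := (1 - delta) * p + delta * phi.
have dphi : 0 < delta * phi by rewrite mulr_gt0.
have dp : 0 < (1 - delta) * p by rewrite mulr_gt0.
have q_ge : delta * phi <= q by rewrite lerDr mulr_ge0// ltW.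
have q_gt0 : 0 < q by exact: lt_le_trans q_ge.
have b_ge : (1 - delta) * p <= b by rewrite lerDl ltW.
have b_gt0 : 0 < b by exact: lt_le_trans b_ge.
(* Both correction terms carry the factor (1 - delta) p / b, which is at most 1. *)
have -> : p ^+ 2 / q = p + ((1 - delta) * p / b) * (p * (p - q0) / q)
    + delta * ((1 - delta) * p / b) / (1 - delta) * (p - phi).
  rewrite /q /b; field; rewrite !gt_eqF//.
have c0 : 0 <= (1 - delta) * p / b by rewrite divr_ge0// ltW.
have c1 : (1 - delta) * p / b <= 1 by rewrite ler_pdivrMr// mul1r.
set c := (1 - delta) * p / b in c0 c1 *.
apply: lerD; first apply: lerD => //.
- rewrite (le_trans (ler_norm _))// normrM (ger0_norm c0).
  rewrite (le_trans (ler_piMl (normr_ge0 _) c1))//.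
  rewrite !normrM distrC (gtr0_norm p0) !(@gtr0_norm _ _^-1) ?invr_gt0//.
  have qi : q^-1 <= delta^-1 * phi^-1 by rewrite -invfM lef_pV2 ?posrE.
  rewrite (le_trans (ler_wpM2l _ qi)) ?mulr_ge0 ?(ltW p0)//.
  by rewrite le_eqVlt; apply/orP; left; apply/eqP; ring.
- rewrite (le_trans (ler_norm _))// normrM ler_wpM2r//.
  rewrite ger0_norm; last by rewrite divr_ge0 ?(ltW d1')// mulr_ge0// ltW.
  by rewrite ler_pM2r ?invr_gt0// -[leRHS]mulr1 ler_wpM2l// ltW.
Qed.

(** Integrating the pointwise bound; the Cauchy-Schwarz inequality is used on
    the product space at once, which also moves the square root outside the
    average over the random density q0. *)
Lemma integral_sqr_ratio_mixture_le d1 d2 (E : measurableType d1)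
    (T : measurableType d2) (R : realType) (m : probability E R)
    (la : {sigma_finite_measure set T -> \bar R})
    (delta : R) (p phi f : T -> R) (q0 : E * T -> R) :
  0 < delta < 1 -> (forall x, 0 < p x) -> (forall x, 0 < phi x) ->
  (forall z, 0 <= q0 z) -> measurable_fun setT p -> measurable_fun setT phi ->
  measurable_fun setT f -> measurable_fun setT q0 ->
  (\int[m \x la]_z ((f z.2 * p z.2) ^+ 2 /
      ((1 - delta) * q0 z + delta * phi z.2))%:E <=
   \int[la]_x (f x ^+ 2 * p x)%:E
   + delta^-1%:E * (sqrte (\int[m \x la]_z ((q0 z - p z.2) ^+ 2)%:E) *
                    sqrte (\int[la]_x ((f x ^+ 2 * (p x / phi x)) ^+ 2)%:E))
   + (delta / (1 - delta))%:E * \int[la]_x (`|p x - phi x| * f x ^+ 2)%:E)%E.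
Proof.
move=> d01 p0 phi0 q00 mp mphi mf mq0; have /andP[delta_gt0 delta_lt1] := d01.
have delta_lt1' : 0 < 1 - delta by rewrite subr_gt0.
pose mu := (m \x la)%E.
have m2 (h : T -> R) : measurable_fun setT h ->
    measurable_fun setT (fun z : E * T => h z.2).
  by move=> mh; exact: measurableT_comp.
pose a (z : E * T) := f z.2 ^+ 2 * p z.2.
pose u (z : E * T) := q0 z - p z.2.
pose v (x : T) := f x ^+ 2 * (p x / phi x).
pose c (x : T) := `|p x - phi x| * f x ^+ 2.
have mf2 : measurable_fun setT (fun x => f x ^+ 2) by exact: measurable_funX.
have ma' : measurable_fun setT (fun x => f x ^+ 2 * p x) by exact: measurable_funM.
have ma : measurable_fun setT a by exact: (m2 _ ma').
have mu_ : measurable_fun setT u by apply: measurable_funB => //; exact: m2.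
have mv' : measurable_fun setT v.
  apply: measurable_funM => //; apply: measurable_funM => //.
  exact: measurable_funV_gt0.
have mv := m2 _ mv'.
have mc' : measurable_fun setT c.
  apply: measurable_funM => //; apply: measurableT_comp => //.
  exact: measurable_funB.
have mc := m2 _ mc'.
have muv : measurable_fun setT (fun z => `|u z * v z.2|).
  by apply: measurableT_comp => //; exact: measurable_funM.
have a0 z : 0 <= a z by rewrite mulr_ge0 ?sqr_ge0// ltW.
have c0 x : 0 <= c x by rewrite mulr_ge0 ?sqr_ge0.
have di0 : 0 <= delta^-1 by rewrite invr_ge0 ltW.
have dd0 : 0 <= delta / (1 - delta) by rewrite divr_ge0// ltW.
have q_gt0 z : 0 < (1 - delta) * q0 z + delta * phi z.2.
  by rewrite ltr_wpDl ?mulr_gt0// mulr_ge0// ltW.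
have mq : measurable_fun setT (fun z => (1 - delta) * q0 z + delta * phi z.2).
  by apply: measurable_funD; apply: measurable_funM => //; exact: m2.
apply: (@le_trans _ _ (\int[mu]_z ((a z)%:E + delta^-1%:E * `|u z * v z.2|%:E
    + (delta / (1 - delta))%:E * (c z.2)%:E))%E).
  apply: ge0_le_integral => //.
  - by move=> z _; rewrite lee_fin divr_ge0 ?sqr_ge0// ltW.
  - apply/measurable_EFinP; apply: measurable_funM; last exact: measurable_funV_gt0.
    by apply: measurable_funX; apply: measurable_funM; exact: m2.
  - apply/measurable_EFinP; apply: measurable_funD; last exact: measurable_funM.
    by apply: measurable_funD => //; exact: measurable_funM.
  move=> z _; rewrite -!EFinM -!EFinD lee_fin.
  have := ler_wpM2l (sqr_ge0 (f z.2))
    (sqr_ratio_mixture_le d01 (p0 z.2) (phi0 z.2) (q00 z)).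
  rewrite [X in X <= _]mulrA -exprMn => /le_trans; apply.
  rewrite /a /u /v /c; move: (f z.2 ^+ 2) (sqr_ge0 (f z.2)) => F F0.
  rewrite !normrM (ger0_norm F0).
  by rewrite le_eqVlt; apply/orP; left; apply/eqP; ring.
rewrite ge0_integralD//; last 4 first.
- by move=> z _; rewrite -EFinM -EFinD lee_fin addr_ge0// mulr_ge0.
- apply/measurable_EFinP; apply: measurable_funD => //; exact: measurable_funM.
- by move=> z _; rewrite -EFinM lee_fin mulr_ge0.
- by apply/measurable_EFinP; exact: measurable_funM.
rewrite ge0_integralD//; last 4 first.
- by move=> z _; rewrite lee_fin.
- exact/measurable_EFinP.
- by move=> z _; rewrite -EFinM lee_fin mulr_ge0.
- by apply/measurable_EFinP; exact: measurable_funM.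
rewrite ge0_integralZl_EFin//; last exact/measurable_EFinP.
rewrite ge0_integralZl_EFin//; last 2 first.
- by move=> z _; rewrite lee_fin.
- exact/measurable_EFinP.
rewrite (ge0_integral_snd m la (h := EFin \o c)); last 2 first.
- exact/measurable_EFinP.
- by move=> z; rewrite lee_fin.
rewrite (ge0_integral_snd m la (h := fun x => (f x ^+ 2 * p x)%:E)); last 2 first.
- exact/measurable_EFinP.
- by move=> x; rewrite lee_fin mulr_ge0 ?sqr_ge0// ltW.
rewrite leeD2r// leeD2l// lee_wpmul2l ?lee_fin//.
have half2 : 2^-1 + 2^-1 = 1 :> R by rewrite [RHS]splitr !div1r.
have := @hoelder _ _ _ (m \x la)%E _ _ 2 2 mu_ mv (ltr0Sn R 1) (ltr0Sn R 1) half2.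
rewrite Lnorm1 !Lnorm2E.
rewrite (ge0_integral_snd m la (h := fun x => (v x ^+ 2)%:E))//.
- by apply/measurable_EFinP; exact: measurable_funX.
- by move=> x; rewrite lee_fin sqr_ge0.
Qed.

(** * The defensive importance sampling estimator *)

Theorem theorem4p7 (R : realType) (disp : measure_display)
  (Om : measurableType disp) (Pr : probability Om R) (d n : nat) (hn : (0 < n)%N)
  (P : probability (d.-tuple R) R) (p : d.-tuple R -> R)
  (hP : has_density P p) (hp : forall x, 0 < p x)
  (delta : R) (hdelta : 0 < delta < 1)
  (phi : d.-tuple R -> R) (hphi : is_density phi) (hphi0 : forall x, 0 < phi x)
  (F : set (set Om)) (hF : is_sub_sigma_algebra F)
  (Q : Om -> probability (d.-tuple R) R) (hQ : sigma_of Q `<=` F)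
  (q0 : Om -> d.-tuple R -> R) (hq0 : random_density (sigma_of Q) q0)
  (hQq : {ae Pr, forall w, has_density (Q w) (mixture delta (q0 w) phi)})
  (hPQ : {ae Pr, forall w, P `<< Q w})
  (X : 'I_n -> {RV Pr >-> d.-tuple R})
  (hXi : cond_independent (sigma_of Q) X)
  (hXd : forall i, cond_distribution (sigma_of Q) (X i) Q)
  (Z : {RV Pr >-> d.-tuple R})
  (hZd : forall A, measurable A -> distribution Pr Z A = P A)
  (hZi : independent_of F Z)
  (f : d.-tuple R -> R) (hf : f \in Lfun P 2%:E)
  (hf2 : (weighted_norm P p phi (fun x => f x ^+ 2)%R < +oo)%E)
  (h1 : (weighted_norm P p phi (fun=> 1%R) < +oo)%E)
  (hpphi : (weighted_L1_dist p phi f < +oo)%E)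
  (hMISE : (MISE Pr q0 p < +oo)%E) :
  let I := \int[lebesgue_Rd R d]_x (f x * p x) in
  let In := importance_estimator p (fun w => mixture delta (q0 w) phi) X f in
  let s2 := sigma2 delta P p phi q0 Z f in
  [/\ unbiased_estimator Pr In I,
      ('V_Pr[In] <= s2 * (n%:R^-1)%:E)%E &
      ('E_Pr[(fun w => `|In w - I|)%R] <= sqrte s2 * ((Num.sqrt n%:R)^-1)%:E)%E].
Proof.
move=> I In s2.
have [[mp _ _] PE] := hP; have [mphi _ _] := hphi; have [dq0 mq0] := hq0.
have /andP[delta_gt0 delta_lt1] := hdelta.
have delta_lt1' : 0 < 1 - delta by rewrite subr_gt0.
have p_ge0 x : 0 <= p x by exact: ltW.
have mf : measurable_fun setT f by move: hf; rewrite inE => /andP[/[!inE]/=].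
pose la := lebesgue_Rd R d.
have PlaE (h : d.-tuple R -> R) : measurable_fun setT h -> (forall x, 0 <= h x) ->
    (\int[P]_x (h x)%:E = \int[la]_x (h x * p x)%:E)%E.
  move=> mh h0; apply: (ge0_integral_density mp p_ge0 PE).
    exact/measurable_EFinP.
  by move=> x; rewrite lee_fin.
have mf2 : measurable_fun setT (fun x => f x ^+ 2) by exact: measurable_funX.
pose g x := f x * p x.
have mg : measurable_fun setT g by exact: measurable_funM.
have f1 : f \in Lfun P 1.
  by apply: Lfun_subset12 hf; exact: fin_num_measure.
have ig : la.-integrable setT (EFin \o g).
  apply/integrableP; split; first exact/measurable_EFinP.
  have /Lfun1_integrable/integrableP[_] := f1.
  apply: le_lt_trans; rewrite le_eqVlt; apply/orP; left; apply/eqP.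
  rewrite [RHS](PlaE (fun x => `|f x|))//; last exact: measurableT_comp.
  by apply: eq_integral => x _ /=; rewrite /g normrM (ger0_norm (p_ge0 x)).
(* The environment: the sigma-algebra generated by the proposal. *)
pose G := sigma_of Q.
have sG : sigma_algebra setT G.
  by apply: sigma_algebra_preimage; exact: smallest_sigma_algebra.
have Gm : G `<=` measurable by apply: subset_trans hQ _; exact: hF.2.
pose E := g_sigma_algebraType G.
pose V := id_RV Pr sG Gm.
pose q0' (z : E * d.-tuple R) := q0 z.1 z.2.
pose q (z : E * d.-tuple R) := (1 - delta) * q0' z + delta * phi z.2.
have q0'_ge0 z : 0 <= q0' z by have [_ h _] := dq0 z.1; exact: h.
have q_gt0 z : 0 < q z.
  by rewrite ltr_wpDl ?mulr_gt0// mulr_ge0// ltW.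
have mq : measurable_fun setT q.
  apply: measurable_funD; apply: measurable_funM => //.
  exact: measurableT_comp.
have Qq : {ae Pr, forall w A, measurable A ->
    Q w A = (\int[la]_(x in A) (q (w, x))%:E)%E}.
  by apply: filterS hQq => w [_ QE] A mA; exact: QE.
have X1 i : joint_density la V (X i) q.
  by apply: cond_distribution_joint_density => //; exact: Qq.
have X2 i j : i != j ->
    joint_density (sigma_finite_prod la la) V (pair_RV X i j) (prod_density q).
  by move=> ij; apply: cond_independent_joint_density => //; exact: Qq.
have laI : (\int[la]_x (g x)%:E = I%:E)%E.
  by rewrite /I /Rintegral fineK//; exact: integrable_fin_num ig.
have IP : (\int[P]_x (f x)%:E = I%:E)%E.
  by rewrite (integral_density mp p_ge0 PE mf).
have MISEE : MISE Pr q0 p =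
    (\int[distribution Pr V \x la]_z ((q0' z - p z.2) ^+ 2)%:E)%E.
  have ms : measurable_fun setT (fun z => ((q0' z - p z.2) ^+ 2)%:E).
    apply/measurable_EFinP; apply: measurable_funX; apply: measurable_funB => //.
    exact: measurableT_comp.
  have s0 z : (0 <= ((q0' z - p z.2) ^+ 2)%:E)%E by rewrite lee_fin sqr_ge0.
  rewrite fubini_tonelli1// ge0_integral_distribution//.
  - exact: measurable_fun_fubini_tonelli_F.
  - by move=> w; apply: integral_ge0.
have wnE : weighted_norm P p phi (fun x => f x ^+ 2) =
    sqrte (\int[la]_x ((f x ^+ 2 * (p x / phi x)) ^+ 2)%:E)%E.
  rewrite /weighted_norm Lnorm2E PlaE; last 2 first.
  - apply: measurable_funX; apply: measurable_funM; last exact: measurable_funV_gt0.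
    apply: measurable_funM => //.
    rewrite (_ : (fun x => Num.sqrt (p x)) = (@powR R ^~ 2^-1) \o p).
      exact: measurableT_comp.
    by apply/funext => x /=; rewrite powR12_sqrt.
  - by move=> x; rewrite sqr_ge0.
  congr sqrte; apply: eq_integral => x _; congr EFin.
  have phix : phi x != 0 by rewrite gt_eqF.
  rewrite -[X in _ * X = _](sqr_sqrtr (p_ge0 x)) -[X in _ = (_ * (X / _)) ^+ 2](sqr_sqrtr (p_ge0 x)).
  by field.
have f2lty : (\int[P]_x (f x ^+ 2)%:E < +oo)%E.
  exact: integrable_lty (Lfun2_integrable_sqr hf).
have VZ : ('V_Pr[f \o Z] = \int[la]_x (f x ^+ 2 * p x)%:E - (I ^+ 2)%:E)%E.
  have EZ (h : d.-tuple R -> \bar R) :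
      (\int[distribution Pr Z]_x h x = \int[P]_x h x)%E.
    by apply: eq_measure_integral => A mA _; exact: hZd.
  have EZ2 : (\int[Pr]_w (f (Z w) ^+ 2)%:E = \int[P]_x (f x ^+ 2)%:E)%E.
    rewrite -EZ ge0_integral_distribution//; first exact/measurable_EFinP.
    by move=> x; rewrite lee_fin sqr_ge0.
  have fZ2 : f \o Z \in Lfun Pr 2%:E.
    by apply: Lfun2_sqr_lty; [exact: measurableT_comp|rewrite EZ2].
  have fZ1 : f \o Z \in Lfun Pr 1.
    by apply: Lfun_subset12 fZ2; exact: fin_num_measure.
  have EfZ : ('E_Pr[f \o Z] = I%:E)%E.
    rewrite unlock -IP -EZ integral_distribution//; first exact/measurable_EFinP.
    exact/Lfun1_integrable.
  rewrite varianceE// EfZ -EFin_expe -PlaE//; last by move=> x; rewrite sqr_ge0.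
  by rewrite -EZ2 unlock.
have InE : In = sample_mean V X q g.
  apply/funext => w; rewrite /In /importance_estimator /sample_mean.
  congr (_ * _); apply: eq_bigr => i _.
  by rewrite /weighted_sample /g /mixture mulrAC [f _ * _]mulrC.
have M2_le := integral_sqr_ratio_mixture_le (distribution Pr V) la hdelta
  hp hphi0 q0'_ge0 mp mphi mf mq0.
rewrite -/(second_moment la V q g) -MISEE -wnE -/(weighted_L1_dist p phi f) in M2_le.
have di0 : 0 <= delta^-1 by rewrite invr_ge0 ltW.
have dd0 : 0 <= delta / (1 - delta) by rewrite divr_ge0// ltW.
have MISE0 : (0 <= MISE Pr q0 p)%E.
  by apply: integral_ge0 => w _; apply: integral_ge0 => x _; rewrite lee_fin sqr_ge0.
have wd0 : (0 <= weighted_L1_dist p phi f)%E.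
  by apply: integral_ge0 => x _; rewrite lee_fin mulr_ge0 ?sqr_ge0.
have wn0 : (0 <= weighted_norm P p phi (fun x => (f x ^+ 2)%R))%E by exact: Lnorm_ge0.
have M2_lty : (second_moment la V q g < +oo)%E.
  apply: le_lt_trans M2_le _; apply: lte_add_pinfty; first apply: lte_add_pinfty.
  - by rewrite -PlaE// => x; rewrite sqr_ge0.
  - rewrite lte_mul_pinfty ?lee_fin// lte_mul_pinfty ?sqrte_ge0//.
    by rewrite sqrte_fin_num// ge0_fin_numE.
  - by rewrite lte_mul_pinfty ?lee_fin.
have s2E : (s2 = \int[la]_x (f x ^+ 2 * p x)%:E
    + delta^-1%:E * (sqrte (MISE Pr q0 p) *
        weighted_norm P p phi (fun x => (f x ^+ 2)%R))
    + (delta / (1 - delta))%:E * weighted_L1_dist p phi f - (I ^+ 2)%:E)%E.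
  by rewrite /s2 /sigma2 VZ -muleA [RHS]addeAC [X in _ = (X + _)%E]addeAC.
have s20 : (0 <= s2)%E.
  rewrite /s2 /sigma2 !adde_ge0 ?variance_ge0 ?mule_ge0 ?lee_fin ?sqrte_ge0//.
have V_le : ('V_Pr[In] <= s2 * (n%:R^-1)%:E)%E.
  rewrite InE (sample_mean_variance mq q_gt0 ig X1 X2 M2_lty hn) lee_wpmul2r ?lee_fin ?invr_ge0// s2E.
  exact: leeD2r.
have In2 : In \in Lfun Pr 2%:E by rewrite InE; exact: sample_mean_Lfun2 mq q_gt0 ig X1 M2_lty.
have EIn : ('E_Pr[In] = I%:E)%E by rewrite InE; exact: sample_mean_expectation mq q_gt0 ig X1 M2_lty hn.
split => //.
- by split => //; apply: Lfun_subset12 In2; exact: fin_num_measure.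
- apply: le_trans (expectation_abs_dev_le In2 EIn) _.
  rewrite -sqrtrV ?ler0n// -[(Num.sqrt n%:R^-1)%:E]/(sqrte (n%:R^-1)%:E) -sqrteM//.
  by rewrite lee_sqrt// mule_ge0// lee_fin invr_ge0.
Qed.
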